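(* Let $1<p\le\infty$ and let $X$ be a Banach space. The following statements are equivalent: (i) $X^{*}$ has the $p$-$(DPrcP)$. (ii) $X$ has the $(SR^{*})_{1,p}$ property and $X^{*}$ contains no isomorphic copy of $c_0$.
   Context: For $1\le r\le\infty$: a sequence $(x_n)_n$ in a Banach space $Z$ is weakly $r$-summable if $(z^{*}(x_n))_n\in\ell_r$ for every $z^{*}\in Z^{*}$ when $r<\infty$; weakly $\infty$-summable means weakly null. A bounded subset $K\subseteq Z$ is a Dunford-Pettis set if every weakly null sequence in $Z^{*}$ converges to zero uniformly on $K$. A sequence in $Z$ is $r$-Right null if it is weakly $r$-summable and its set of terms is a Dunford-Pettis set. $Z$ has the $r$-Dunford-Pettis relatively compact property ($r$-$(DPrcP)$) if every $r$-Right null sequence in $Z$ is norm null. A bounded subset $K\subseteq X$ is an $r$-Right$^{*}$ set if $\lim_n\sup_{x\in K}|x_n^{*}(x)|=0$ for every $r$-Right null sequence $(x_n^{*})_n$ in $X^{*}$. For $1\le r<s\le\infty$, $X$ has the $(SR^{*})_{r,s}$ property if every $r$-Right$^{*}$ set in $X$ is an $s$-Right$^{*}$ set in $X$. *)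

(* Defs.v *)
From HB Require Import structures.
From mathcomp Require Import all_boot all_order all_algebra.
From mathcomp Require Import all_classical all_reals all_analysis.

Set Implicit Arguments.
Unset Strict Implicit.
Unset Printing Implicit Defensive.

Import Order.TTheory GRing.Theory Num.Theory.
Import numFieldNormedType.Exports.

Local Open Scope classical_set_scope.
Local Open Scope ring_scope.

Section dual_space.
Context {R : realType} (X : normedModType R).

Definition dual_pred : {pred X -> R^o} :=
  mem [set f : X -> R^o | linear f /\ continuous f].

Record dual := Dual { dual_fun : X -> R^o ; dual_funP : dual_fun \in dual_pred }.

HB.instance Definition _ := [isSub for dual_fun].
HB.instance Definition _ := [Choice of dual by <:].

Lemma dual_submod_closed : submod_closed dual_pred.
Proof.
split.
  rewrite inE /=; split; last exact: cst_continuous.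
  by move=> a x y; rewrite -[RHS]/(a *: (0 : R^o) + 0) scaler0 addr0.
move=> a f g; rewrite !inE /= => -[lf cf] [lg cg]; split.
  move=> b x y; rewrite -![(_ + g) _]/(a *: f _ + g _) lf lg.
  by rewrite !scalerDr !scalerA (mulrC a b) addrACA.
move=> x; apply: cvgD; last exact: cg.
by apply: cvgZr; exact: cf.
Qed.

HB.instance Definition _ := GRing.isSubmodClosed.Build _ _ dual_pred
  dual_submod_closed.
HB.instance Definition _ := [SubChoice_isSubLmodule of dual by <:].

End dual_space.

Coercion dual_fun : dual >-> Funclass.

Section dual_norm.
Context {R : realType} (X : normedModType R).
Implicit Types (f g : dual X) (x : X).

Lemma dual_linear f : linear f.
Proof. by have := dual_funP f; rewrite inE => -[]. Qed.

HB.instance Definition _ f :=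
  GRing.isLinear.Build R X R^o _ (dual_fun f) (dual_linear f).

Lemma dual_continuous f : continuous f.
Proof. by have := dual_funP f; rewrite inE => -[]. Qed.

Definition dual_norm f : R := sup [set `|f x| | x in [set x : X | `|x| <= 1]].

Lemma dual_norm_has_sup f : has_sup [set `|f x| | x in [set x : X | `|x| <= 1]].
Proof.
split; first by exists `|f 0|; exists 0 => //=; rewrite normr0.
have /bounded_funP/(_ 1)[M fM] : bounded_near (dual_fun f) (nbhs (0 : X)).
  exact/linear_bounded_continuous/dual_continuous.
by exists M => _ [x /= x1 <-]; exact: fM.
Qed.

Lemma dual_norm_ball f x : `|x| <= 1 -> `|f x| <= dual_norm f.
Proof.
move=> x1; apply: ub_le_sup; last by exists x.
by case: (dual_norm_has_sup f).
Qed.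

Lemma dual_norm_le f (M : R) :
  (forall x, `|x| <= 1 -> `|f x| <= M) -> dual_norm f <= M.
Proof.
move=> fM; apply: ge_sup; first by case: (dual_norm_has_sup f).
by move=> _ [x /= x1 <-]; exact: fM.
Qed.

Lemma dual_norm_ge0 f : 0 <= dual_norm f.
Proof. by apply: le_trans (@dual_norm_ball f 0 _); rewrite ?normr0. Qed.

Lemma le_dual_norm f x : `|f x| <= dual_norm f * `|x|.
Proof.
have [->|x0] := eqVneq x 0; first by rewrite linear0 !normr0 mulr0.
have nx0 : 0 < `|x| by rewrite normr_gt0.
rewrite -ler_pdivrMr// mulrC -[`|x|^-1]ger0_norm ?invr_ge0// -normrM.
have -> : `|x|^-1 * f x = f (`|x|^-1 *: x) by rewrite linearZ.
by apply: dual_norm_ball; rewrite normrZ ger0_norm ?invr_ge0// mulVf ?gt_eqF.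
Qed.

Lemma dual_normD f g : dual_norm (f + g) <= dual_norm f + dual_norm g.
Proof.
apply: dual_norm_le => x x1; apply: le_trans (ler_normD _ _) _.
by rewrite lerD// dual_norm_ball.
Qed.

Lemma dual_normZ_le (l : R) f : dual_norm (l *: f) <= `|l| * dual_norm f.
Proof.
apply: dual_norm_le => x x1.
by rewrite [leLHS](normrM l (f x)) ler_wpM2l// dual_norm_ball.
Qed.

Lemma dual_normZ (l : R) f : dual_norm (l *: f) = `|l| * dual_norm f.
Proof.
apply/eqP; rewrite eq_le dual_normZ_le/=.
have [->|l0] := eqVneq l 0; first by rewrite normr0 mul0r dual_norm_ge0.
rewrite -ler_pdivlMl ?normr_gt0// -normfV.
by rewrite -{1}(scalerK l0 f) dual_normZ_le.
Qed.

Lemma dual_norm0_eq0 f : dual_norm f = 0 -> f = 0.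
Proof.
move=> f0; apply/val_inj/funext => x; apply/eqP; rewrite -normr_le0.
by rewrite (le_trans (le_dual_norm f x))// f0 mul0r.
Qed.

HB.instance Definition _ := @Lmodule_isNormed.Build R (dual X)
  dual_norm dual_normD dual_normZ dual_norm0_eq0.

Lemma dual_normE f : `|f| = dual_norm f. Proof. by []. Qed.

Lemma dualBE f g x : (f - g) x = f x - g x. Proof. by []. Qed.

Lemma dual_complete (F : set_system (dual X)) :
  ProperFilter F -> cauchy F -> cvg F.
Proof.
move=> FF Fc; have Fe : cauchy_ex F by exact/cauchyP.
have dist f g x : `|f x - g x| <= `|f - g| * `|x|.
  by rewrite -dualBE le_dual_norm.
have cvx x : cvg ((f : dual X) x @[f --> F]).
  apply: cauchy_cvg; apply: cauchy_exP => e e0.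
  have d0 : 0 < e / (`|x| + 1) by rewrite divr_gt0// ltr_wpDl.
  have [f Ff] := Fe _ d0; exists (f x).
  apply: (@filterS (dual X) F _ _ _ _ Ff) => h.
  rewrite /= -!ball_normE /= => fh; apply: (le_lt_trans (dist _ _ _)).
  move: fh; rewrite ltr_pdivlMr ?ltr_wpDl//; apply: le_lt_trans.
  by rewrite ler_wpM2l// lerDl.
pose g (x : X) : R^o := lim ((f : dual X) x @[f --> F]).
have gl : linear g.
  move=> a x y; apply/cvg_lim => //.
  rewrite (_ : (fun _ => _) = (fun f : dual X => a *: f x + f y)); last first.
    by apply/funext => f; rewrite linearP.
  by apply: cvgD; [apply: cvgZr; exact: cvx|exact: cvx].
have unif e : 0 < e ->
    \forall f \near F, forall x, `|(f : dual X) x - g x| <= e * `|x|.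
  move=> e0.
  have Fd : \forall f \near F, \forall h \near F, ball f e h.
    by apply: nearP_dep; move/cauchy_ballP: Fc; exact.
  apply: (@filterS (dual X) F _ _ _ _ Fd) => f Ff x.
  have fgx : `|f x - (h : dual X) x| @[h --> F] --> `|f x - g x|.
    by apply: (@cvg_norm _ R^o); apply: cvgB; [exact: cvg_cst|exact: cvx].
  apply: (cvgr_to_le fgx).
  apply: (@filterS (dual X) F _ _ _ _ Ff) => h.
  rewrite -ball_normE/= => /ltW fh.
  by rewrite (le_trans (dist _ _ _))// ler_wpM2r.
have gc : continuous g.
  pose gL := GRing.isLinear.Build R X R^o _ g gl.
  pose g' : {linear X -> R^o} := HB.pack g gL.
  apply: (@bounded_linear_continuous _ _ _ g').
  apply/linear_boundedP.
  have /filter_ex[f fg] := unif 1 ltr01.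
  exists (dual_norm f + 1); split => [|r /ltW fr x]; first exact: num_real.
  rewrite -[g' x](subKr (f x)) (le_trans (ler_normB _ _))//.
  rewrite (le_trans (lerD (le_dual_norm f x) (fg x)))// -mulrDl.
  by rewrite ler_wpM2r.
have gP : g \in @dual_pred R X by rewrite inE.
apply/cvg_ex; exists (Dual gP); apply/cvgrPdist_le => e e0.
have := unif _ e0; apply: filterS => f fg.
rewrite distrC; apply: dual_norm_le => x x1; rewrite dualBE.
by rewrite (le_trans (fg x))// ler_piMr// ltW.
Qed.

HB.instance Definition _ := Uniform_isComplete.Build (dual X) dual_complete.

End dual_norm.

Section c0_space.
Context (R : realType).

Definition c0_pred : {pred nat -> R^o} :=
  mem [set u : nat -> R^o | u @ \oo --> (0 : R^o)].

Record c0 := C0 { c0_fun : nat -> R^o ; c0_funP : c0_fun \in c0_pred }.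

HB.instance Definition _ := [isSub for c0_fun].
HB.instance Definition _ := [Choice of c0 by <:].

Lemma c0_submod_closed : submod_closed c0_pred.
Proof.
split; first by rewrite inE /=; exact: cvg_cst.
move=> a u v; rewrite !inE /= => u0 v0.
rewrite (_ : (0 : R^o) = a *: (0 : R^o) + 0); last by rewrite scaler0 addr0.
by apply: cvgD => //; exact: cvgZr.
Qed.

HB.instance Definition _ := GRing.isSubmodClosed.Build _ _ c0_pred
  c0_submod_closed.
HB.instance Definition _ := [SubChoice_isSubLmodule of c0 by <:].

End c0_space.

Coercion c0_fun : c0 >-> Funclass.

Section c0_norm.
Context {R : realType}.
Implicit Types (u v : c0 R).

Lemma c0_cvg u : u @ \oo --> (0 : R^o).
Proof. by have := c0_funP u; rewrite inE. Qed.

Definition c0_norm u : R := sup (range (fun n => `|u n|)).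

Lemma c0_norm_has_sup u : has_sup (range (fun n => `|u n|)).
Proof.
split; first by exists `|u 0|; exists 0.
have /cvg_seq_bounded/pinfty_ex_gt0[M M0 uM] : cvgn u.
  by apply/cvg_ex; exists 0; exact: c0_cvg.
by exists M => _ [n _ <-]; exact: uM.
Qed.

Lemma le_c0_norm u n : `|u n| <= c0_norm u.
Proof.
apply: ub_le_sup; last by exists n.
by case: (c0_norm_has_sup u).
Qed.

Lemma c0_norm_le u (M : R) : (forall n, `|u n| <= M) -> c0_norm u <= M.
Proof.
move=> uM; apply: ge_sup; first by case: (c0_norm_has_sup u).
by move=> _ [n _ <-]; exact: uM.
Qed.

Lemma c0_normD u v : c0_norm (u + v) <= c0_norm u + c0_norm v.
Proof.
apply: c0_norm_le => n; apply: le_trans (ler_normD _ _) _.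
by rewrite lerD// le_c0_norm.
Qed.

Lemma c0_normZ_le (l : R) u : c0_norm (l *: u) <= `|l| * c0_norm u.
Proof.
apply: c0_norm_le => n.
by rewrite [leLHS](normrM l (u n)) ler_wpM2l// le_c0_norm.
Qed.

Lemma c0_normZ (l : R) u : c0_norm (l *: u) = `|l| * c0_norm u.
Proof.
apply/eqP; rewrite eq_le c0_normZ_le/=.
have [->|l0] := eqVneq l 0.
  by rewrite normr0 mul0r (le_trans _ (le_c0_norm _ 0)).
rewrite -ler_pdivlMl ?normr_gt0// -normfV.
by rewrite -{1}(scalerK l0 u) c0_normZ_le.
Qed.

Lemma c0_norm0_eq0 u : c0_norm u = 0 -> u = 0.
Proof.
move=> u0; apply/val_inj/funext => n; apply/eqP; rewrite -normr_le0.
by rewrite (le_trans (le_c0_norm u n))// u0.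
Qed.

HB.instance Definition _ := @Lmodule_isNormed.Build R (c0 R)
  c0_norm c0_normD c0_normZ c0_norm0_eq0.

End c0_norm.

(* A copy of Y in Z: a linear map that is an isomorphism onto its range. *)
Definition contains_copy {R : realType} (Y Z : normedModType R) : Prop :=
  exists (T : {linear Y -> Z}) (a b : R),
    [/\ 0 < a, 0 < b & forall y, a * `|y| <= `|T y| <= b * `|y|].

Section properties.
Context {R : realType}.
Implicit Types (X Z : completeNormedModType R) (r s p : \bar R).

Definition weakly_null Z (z : nat -> Z) : Prop :=
  forall f : dual Z, f (z n) @[n --> \oo] --> (0 : R^o).

(* Only meaningful for 1 <= r <= +oo. *)
Definition weakly_summable r Z (z : nat -> Z) : Prop :=
  match r with
  | q%:E => forall f : dual Z, cvgn (series (fun n => `|f (z n)| `^ q))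
  | +oo%E => weakly_null z
  | -oo%E => False
  end.

Definition dunford_pettis_set Z (K : set Z) : Prop :=
  bounded_set K /\
  forall f : nat -> dual Z, weakly_null f ->
    {uniform K, (fun n => f n : Z -> R^o) @ \oo --> (cst 0 : Z -> R^o)}.

Definition Right_null r Z (z : nat -> Z) : Prop :=
  weakly_summable r z /\ dunford_pettis_set (range z).

Definition DPrcP r Z : Prop :=
  forall z : nat -> Z, Right_null r z -> z @ \oo --> (0 : Z).

(* As K is bounded, each sup is a genuine supremum, with sup set0 = 0. *)
Definition Right_star_set r X (K : set X) : Prop :=
  bounded_set K /\
  forall f : nat -> dual X, Right_null r f ->
    sup [set `|f n x| | x in K] @[n --> \oo] --> (0 : R^o).

Definition SRstar r s X : Prop :=
  forall K : set X, Right_star_set r K -> Right_star_set s K.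

End properties.

(* Main.v *)
From HB Require Import structures.
Require Import Defs.
From mathcomp Require Import all_boot all_order all_algebra.
From mathcomp Require Import all_classical all_reals all_analysis.
From mathcomp Require Import lra.

Set Implicit Arguments.
Unset Strict Implicit.
Unset Printing Implicit Defensive.

Import Order.TTheory GRing.Theory Num.Theory.
Import numFieldNormedType.Exports.

Local Open Scope classical_set_scope.
Local Open Scope ring_scope.

(** If X* contains no copy of c0, weakly 1-summable sequences of X* are norm
    null (the Bessaga-Pelczynski principle, in its easy form for dual spaces),
    so the closed unit ball of X is a 1-Right* set.  If moreover 1-Right* sets
    are p-Right* sets, the ball is a p-Right* set; since the supremum of a
    functional over the ball is its norm, that is exactly the p-(DPrcP) of X*.

    The Bessaga-Pelczynski step never leaves the duality between X and X*.  Let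
    x_n in X* be weakly 1-summable and not norm null.  Banach-Steinhaus bounds
    the sums of |x_n u| by C |u| ([wuC_bound_of_pointwise]).  Choose u_k in the
    ball of X almost norming x_k along a subsequence; Rosenthal's lemma
    ([rosenthal_disjointification]) makes the matrix x_n (u_k) nearly diagonal
    on a further subsequence, and then a |-> (u |-> sum of a_n x_n u) embeds c0
    in X*: the bound C gives the upper estimate, the points u_k the lower one
    ([c0_copy_of_almost_biorthogonal]).

    Conversely, if X* has the p-(DPrcP), then p-Right null sequences of X* are
    norm null, so all bounded sets of X are p-Right* sets, and it remains to
    exclude a copy T of c0 in Z = X*.  The images z_n = T e_n satisfy
    sum of |f (z_n)| <= B |f| for f in Z*, so they are weakly r-summable for all
    r >= 1.  They also form a Dunford-Pettis set: for f_k weakly null in Z*,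
    each set S of indices gives the functional f |-> sum over S of f (z_n) on
    Z*, whose values at f_k tend to 0, and a gliding hump
    ([gliding_hump], the core of the Schur property of l1) turns this into
    convergence uniform in n.  As T is bounded below, (z_n) is not norm null. *)

(** * Rosenthal's disjointification lemma *)

(** Induction on the number m of units of mass e that a row may carry.  Split
    the indices into infinitely many infinite blocks, indexed by pairs.  Either
    one block works, or each block i has a row of index d i whose mass inside
    the block, off the diagonal, exceeds e.  Those rows have lost e when one
    keeps only the indices d j, as d j meets block i only at the diagonal: the
    submatrix on the d j satisfies the hypothesis with m - 1. *)
Lemma rosenthal_disjointification (R : realType) (e : R) (m : nat)
    (a : nat -> nat -> R) :
    0 <= e -> (forall k n, 0 <= a k n) ->
    (forall k s, uniq s -> \sum_(n <- s) a k n <= e *+ m) ->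
  exists2 h : nat -> nat, injective h &
    forall k s, uniq s -> k \notin s -> \sum_(n <- s) a (h k) (h n) <= e.
Proof.
move=> e0; elim: m a => [|m IH] a a0 am.
  exists id => // k s us _; exact: le_trans (am k s us) _.
pose g (i j : nat) : nat := pickle (i, j).
have gI i j i' j' : g i j = g i' j' -> i = i' /\ j = j'.
  by move=> /(pcan_inj pickleK)[].
case: (pselect (exists i, forall k s, uniq s -> k \notin s ->
    \sum_(n <- s) a (g i k) (g i n) <= e)) => [[i gi]|no].
  by exists (g i) => // j j' /gI[].
have /choice[w wP] : forall i, exists w : nat * seq nat,
    [/\ uniq w.2, w.1 \notin w.2 & e < \sum_(n <- w.2) a (g i w.1) (g i n)].
  move=> i; apply: contrapT => nw; apply: no; exists i => k s us ks.
  by rewrite leNgt; apply/negP => es; apply: nw; exists (k, s).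
pose d i := g i (w i).1.
have dI : injective d by move=> i j /gI[].
case: (IH (fun i j => a (d i) (d j))) => // [i s us|h hI hP].
  have [uw ww ew] := wP i.
  have := am (d i) (map d s ++ map (g i) (w i).2).
  rewrite cat_uniq !map_inj_uniq//; last by move=> j j' /gI[].
  rewrite us uw andbT/= big_cat/= !big_map mulrSr => /(_ _) le_e.
  suff /le_e : ~~ has (in_mem^~ (mem (map d s))) (map (g i) (w i).2).
    by rewrite -/(d i) in ew *; move: ew; rewrite -/(d i); lra.
  apply/hasPn => _ /mapP[n nw ->]; apply/mapP => -[j _ /gI[ij nk]].
  by move: nw ww; rewrite nk -ij => ->.
by exists (d \o h) => //; exact: inj_comp.
Qed.

(** * Absolutely summable families and the functionals they define *)

Section abs_bounded_sums.
Context {R : realType}.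
Implicit Types (a b : nat -> R) (C : R).

Lemma series_abs_bounded_cvg a C :
  (forall s, uniq s -> \sum_(n <- s) `|a n| <= C) -> cvgn (series a).
Proof.
move=> aC; apply: (@normed_cvg R R^o); apply: nondecreasing_is_cvgn.
  by apply: nondecreasing_series => n _ _; exact: normr_ge0.
by exists C => _ [n _ <-]; apply: aC; exact: iota_uniq.
Qed.

Lemma series_abs_bounded_le a C (l : R) :
  (forall s, uniq s -> \sum_(n <- s) `|a n| <= C) ->
  series a @ \oo --> l -> `|l| <= C.
Proof.
move=> aC al; have al' : (fun n => `|series a n|) @ \oo --> `|l|.
  exact: (@cvg_norm _ R^o).
apply: (cvgr_to_le al'); near=> n.
by apply: le_trans (ler_norm_sum _ _ _) _; apply: aC; exact: iota_uniq.
Unshelve. all: by end_near. Qed.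

Lemma abs_sum_le_mul a b C (M : R) s : uniq s ->
  (forall n, `|b n| <= M) ->
  (forall t, uniq t -> \sum_(n <- t) `|a n| <= C) ->
  \sum_(n <- s) `|b n * a n| <= M * C.
Proof.
move=> us bM aC; have M0 : 0 <= M by exact: le_trans (bM 0).
apply: (@le_trans _ _ (M * \sum_(n <- s) `|a n|)).
  by rewrite mulr_sumr; apply: ler_sum => n _; rewrite normrM ler_wpM2r.
by rewrite ler_wpM2l// aC.
Qed.

End abs_bounded_sums.

Section functionals.
Context {R : realType}.

Lemma bounded_linear_dual (Y : normedModType R) (g : Y -> R^o) (C : R) :
  linear g -> (forall u, `|g u| <= C * `|u|) ->
  exists h : dual Y, forall u, h u = g u.
Proof.
move=> gl gC.
pose gL := GRing.isLinear.Build R Y R^o _ g gl.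
pose g' : {linear Y -> R^o} := HB.pack g gL.
have gc : continuous g.
  apply: (@bounded_linear_continuous _ _ _ g').
  apply/linear_boundedP; exists C; split => [|r /ltW Cr x].
    by rewrite num_real.
  by apply: le_trans (gC x) _; rewrite ler_wpM2r.
have gP : g \in @dual_pred R Y by rewrite inE.
by exists (Dual gP).
Qed.

(** Quantitative form of weak* unconditional Cauchyness of the series of the x n;
    finite sums over duplicate-free lists make it stable under subsequences. *)
Definition wuC_bound (Y : normedModType R) (x : nat -> dual Y) (C : R) :=
  forall u s, uniq s -> \sum_(n <- s) `|x n u| <= C * `|u|.

(** The sum in the weak* sense of a series in the dual with bounded
    coefficients b; norm convergence fails in general. *)
Lemma wuC_functional (Y : normedModType R) (x : nat -> dual Y) (C : R)
    (b : nat -> R) (M : R) :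
  0 <= C -> wuC_bound x C -> (forall n, `|b n| <= M) ->
  exists g : dual Y, `|g| <= M * C /\
    forall u, series (fun n => b n * x n u) @ \oo --> (g u : R).
Proof.
move=> C0 xC bM; have M0 : 0 <= M by exact: le_trans (bM 0).
have bxC u s : uniq s -> \sum_(n <- s) `|b n * x n u| <= M * (C * `|u|).
  move=> us; apply: (abs_sum_le_mul us bM) => t; exact: xC.
pose g (u : Y) : R^o := limn (series (fun n => b n * x n u)).
have gP u : series (fun n => b n * x n u) @ \oo --> (g u : R).
  exact: series_abs_bounded_cvg (bxC u).
have gM u : `|g u| <= M * C * `|u|.
  by rewrite -mulrA; exact: series_abs_bounded_le (bxC u) (gP u).
have gl : linear g.
  move=> c u v; apply/cvg_lim => //.
  rewrite (_ : series _ = (fun n => c *: (series (fun n => b n * x n u) n : R^o)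
      + series (fun n => b n * x n v) n)); last first.
    apply/funext => n; rewrite /series/= scaler_sumr -big_split/=.
    apply: eq_bigr => i _; rewrite linearP/= mulrDr; congr +%R.
    by rewrite mulrCA.
  by apply: cvgD; [apply: cvgZr; exact: gP|exact: gP].
have [h hg] := bounded_linear_dual gl gM.
exists h; split => [|u]; last by rewrite hg; exact: gP.
apply: dual_norm_le => u u1; rewrite hg (le_trans (gM u))// ler_piMr//.
exact: mulr_ge0.
Qed.

(** The lower estimate comes from testing at u k: there the diagonal term of
    the sum for a is at least 2d |a k| while the other terms add up to at most
    d |a|.  Taking the supremum over k leaves d |a|. *)
Lemma c0_copy_of_almost_biorthogonal (Y : normedModType R) (x : nat -> dual Y) (C d : R)
    (u : nat -> Y) :
  0 <= C -> wuC_bound x C -> 0 < d -> (forall n, `|u n| <= 1) ->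
  (forall n, d *+ 2 <= `|x n (u n)|) ->
  (forall k s, uniq s -> k \notin s -> \sum_(n <- s) `|x n (u k)| <= d) ->
  contains_copy (c0 R) (dual Y).
Proof.
move=> C0 xC d0 u1 xd off.
have /choice[T TP] : forall a : c0 R, exists g : dual Y, `|g| <= `|a| * C /\
    forall v, series (fun n => a n * x n v) @ \oo --> (g v : R).
  by move=> a; apply: wuC_functional => // n; exact: le_c0_norm.
have Tl : linear T.
  move=> c a b; apply/val_inj/funext => v.
  have [_ Tab] := TP (c *: a + b); have [_ Ta] := TP a; have [_ Tb] := TP b.
  apply: (cvg_unique _ (Tab v)) => //.
  rewrite (_ : series _ = (fun n => c *: (series (fun n => a n * x n v) n : R^o)
      + series (fun n => b n * x n v) n)); last first.
    apply/funext => n; rewrite /series/= scaler_sumr -big_split/=.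
    apply: eq_bigr => i _.
    by rewrite [LHS](_ : _ = (c * a i + b i) * x i v)// mulrDl -mulrA.
  by apply: cvgD; [apply: cvgZr; exact: Ta|exact: Tb].
pose TL := GRing.isLinear.Build R (c0 R) (dual Y) _ T Tl.
pose T' : {linear c0 R -> dual Y} := HB.pack T TL.
exists T', d, (C + 1); split => //; first by rewrite ltr_wpDl.
move=> a; have [Ta Tau] := TP a; apply/andP; split; last first.
  by rewrite (le_trans Ta)// mulrC ler_wpM2r// lerDl.
suff ak k : `|a k| * (d *+ 2) <= `|T a| + `|a| * d.
  have : `|a| <= (`|T a| + `|a| * d) / (d *+ 2).
    by apply: c0_norm_le => k; rewrite ler_pdivlMr ?pmulrn_lgt0.
  rewrite ler_pdivlMr ?pmulrn_lgt0// -[T' a]/(T a) mulrC => ?; lra.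
have h1 : `|a k * x k (u k)| <= `|T a| + `|a| * d; last first.
  by apply: le_trans h1; rewrite normrM ler_wpM2l.
have -> : a k * x k (u k) = T a (u k) - (T a (u k) - a k * x k (u k)).
  by rewrite opprB addrC subrK.
apply: le_trans (ler_normB _ _) _; apply: lerD.
  by rewrite (le_trans (le_dual_norm _ _))// ler_piMr// dual_norm_ge0.
(* The off-diagonal part of the series defining [T a (u k)]. *)
pose a' n := if n == k then 0 else a n * x n (u k).
apply: (@series_abs_bounded_le _ a') => [s us|].
  rewrite (bigID (pred1 k))/= big1 => [|n /eqP ->]; last first.
    by rewrite /a' eqxx normr0.
  rewrite add0r; under eq_bigr => n /negPf nk do rewrite /a' nk.
  rewrite -big_filter.
  apply: (@le_trans _ _ (\sum_(n <- [seq n <- s | n != k]) `|a| * `|x n (u k)|)).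
    by apply: ler_sum => n _; rewrite normrM ler_wpM2r// le_c0_norm.
  rewrite -mulr_sumr ler_wpM2l//; apply: off; first exact: filter_uniq.
  by rewrite mem_filter eqxx.
have -> : a' = (fun n => a n * x n (u k) - (n == k)%:R * (a k * x k (u k))).
  apply/funext => n; rewrite /a'; case: eqP => [->|_]; first by rewrite mul1r subrr.
  by rewrite mul0r subr0.
rewrite (_ : series _ = series (fun n => a n * x n (u k)) \-
    series (fun n => (n == k)%:R * (a k * x k (u k)))); last first.
  by apply/funext => n; rewrite /series/= -sumrB.
apply: cvgB; first exact: Tau.
apply: cvg_near_cst; near=> n; rewrite /series/=.
have kn : (k < n)%N by near: n; exact: nbhs_infty_gt.
rewrite -mulr_suml big_mkord (bigD1 (Ordinal kn))//= eqxx big1 ?addr0 ?mul1r//.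
by move=> i; rewrite -val_eqE/= => /negPf ->.
Unshelve. all: by end_near. Qed.

End functionals.

(** * Copies of c0 from weakly summable sequences in a dual *)

Section bessaga_pelczynski.
Context {R : realType}.

Lemma escaping_subsequence (V : normedModType R) (x : nat -> V) :
  ~ (x @ \oo --> (0 : V)) ->
  exists e (h : nat -> nat), [/\ 0 < e, injective h & forall k, e < `|x (h k)|].
Proof.
move=> nx; have [e e0 eP] : exists2 e, 0 < e &
    forall N, exists n, (N <= n)%N /\ e < `|x n|.
  apply: contrapT => no; apply: nx; apply/cvgrPdist_le => e e0.
  apply: contrapT => ne; apply: no; exists e => // N.
  apply: contrapT => nN; apply: ne; exists N => // n /= Nn.
  by rewrite sub0r normrN leNgt; apply/negP => xn; apply: nN; exists n.
have /choice[g gP] := eP.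
pose h k := g (iter k (fun N => (g N).+1) 0%N).
exists e, h; split => // [|k]; last by have [] := gP (iter k (fun N => (g N).+1) 0%N).
have hS : {homo h : i j / (i < j)%N}.
  apply: homo_ltn => [i j k|k]; first exact: ltn_trans.
  by rewrite {2}/h iterS; have [] := gP (g (iter k (fun N => (g N).+1) 0%N)).+1.
by move=> i j hij; case: (ltngtP i j) => // /hS; rewrite hij ltnn.
Qed.

(** Points u k of the unit ball almost norming a subsequence give a matrix with
    large diagonal and bounded row sums; Rosenthal's lemma thins it out until
    the off-diagonal row sums are half of the diagonal. *)
Lemma contains_c0_of_wuC (Y : normedModType R) (x : nat -> dual Y) (C : R) :
  0 <= C -> wuC_bound x C -> ~ (x @ \oo --> (0 : dual Y)) ->
  contains_copy (c0 R) (dual Y).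
Proof.
move=> C0 xC /escaping_subsequence[e [h [e0 hI xe]]].
have /choice[u uP] : forall k, exists u : Y, `|u| <= 1 /\ e < `|x (h k) u|.
  move=> k; apply: contrapT => no; have := xe k; apply/negP; rewrite -leNgt.
  apply: dual_norm_le => v v1; rewrite leNgt; apply/negP => xv.
  by apply: no; exists v.
pose d := e / 2; have d0 : 0 < d by rewrite divr_gt0.
pose a k n := `|x (h n) (u k)|.
have [m Cm] : exists m, C <= d *+ m.
  exists (Num.truncn (C / d)).+1; rewrite -mulr_natr -ler_pdivrMl// mulrC.
  by apply/ltW; exact: truncnS_gt.
have [| |s sI sP] := @rosenthal_disjointification R d m a (ltW d0).
- by move=> k n; exact: normr_ge0.
- move=> k s us; apply: le_trans Cm; rewrite /a.
  have := xC (u k) (map h s); rewrite map_inj_uniq// big_map => /(_ us).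
  by move/le_trans; apply; rewrite ler_piMr//; case: (uP k).
apply: (@c0_copy_of_almost_biorthogonal _ Y (x \o h \o s) C d (u \o s)) => //.
- move=> v t ut; have := xC v (map (h \o s) t).
  by rewrite map_inj_uniq ?big_map//; [exact|exact: inj_comp].
- by move=> n; case: (uP (s n)).
- move=> n; have [_ /ltW] := uP (s n); apply: le_trans.
  by rewrite /d; lra.
Qed.

(** Banach-Steinhaus applied to all finite sums of the x n with coefficients in
    [-1, 1]: pointwise they are bounded by the absolute sum, and the choice of
    the signs of x n u recovers the absolute sum. *)
Lemma wuC_bound_of_pointwise (Y : completeNormedModType R) (x : nat -> dual Y) :
  (forall u, cvgn (series (fun n => `|x n u|))) ->
  exists2 C, 0 <= C & wuC_bound x C.
Proof.
move=> xu.
pose F := [set g : Y -> R^o | exists (s : seq nat) (c : nat -> R),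
  [/\ uniq s, forall n, `|c n| <= 1 & g = dual_fun (\sum_(n <- s) c n *: x n)]].
have Fsum s c u : (\sum_(n <- s) c n *: x n : dual Y) u =
    \sum_(n <- s) c n * x n u.
  by elim/big_rec2: _ => // n y z _ <-.
have [||M MP] := @Banach_Steinhauss R Y R^o F _ _ 1.
- move=> _ [s [c [us c1 ->]]]; split; last exact: dual_linear.
  move=> r; exists (dual_norm (\sum_(n <- s) c n *: x n) * r) => u ur.
  by apply: le_trans (le_dual_norm _ _) _; rewrite ler_wpM2l// dual_norm_ge0.
- move=> u; exists (limn (series (fun n => `|x n u|))) => _ [s [c [us c1 ->]]].
  rewrite Fsum; apply: le_trans (ler_norm_sum _ _ _) _.
  apply: (@le_trans _ _ (\sum_(n <- s) `|x n u|)).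
    by apply: ler_sum => n _; rewrite normrM ler_piMl.
  pose N := (\max_(n <- s) n).+1.
  apply: (@le_trans _ _ (series (fun n => `|x n u|) N)).
    rewrite /series/= [leRHS](bigID (mem s))/= -[leLHS]addr0 lerD ?sumr_ge0//.
    rewrite -[leRHS]big_filter (perm_big [seq n <- index_iota 0 N | n \in s])//.
    apply: uniq_perm => // [|n]; first by rewrite filter_uniq// iota_uniq.
    rewrite mem_filter mem_index_iota/= ltnS.
    by case: (boolP (n \in s)) => //= ns; rewrite leq_bigmax_seq.
  apply: nondecreasing_cvgn_le => //.
  by apply: nondecreasing_series => n _ _; exact: normr_ge0.
have xM u s : `|u| <= 1 -> uniq s -> \sum_(n <- s) `|x n u| <= M.
  move=> u1 us; pose c n := Num.sg (x n u).
  have : `|(\sum_(n <- s) c n *: x n : dual Y) u| <= M.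
    apply: MP => //; exists s, c; split => // n.
    by rewrite /c normr_sg lern1 leq_b1.
  rewrite Fsum; under eq_bigr => n _ do rewrite -normrEsg.
  by rewrite ger0_norm ?sumr_ge0.
exists M => [|u s us]; first by have := xM 0 [::]; rewrite normr0 big_nil; exact.
have [->|u0] := eqVneq u 0.
  by rewrite normr0 mulr0 big1// => n _; rewrite linear0 normr0.
have nu : 0 < `|u| by rewrite normr_gt0.
have := xM (`|u|^-1 *: u) s; rewrite normrZ normfV normr_id mulVf ?gt_eqF//.
move=> /(_ (lexx _) us); under eq_bigr => n _ do rewrite linearZ/= normrM normfV normr_id.
by rewrite -mulr_sumr mulrC ler_pdivrMr.
Qed.

End bessaga_pelczynski.

(** * The gliding hump *)

Section gliding_hump.
Context {R : realType}.

Lemma abs_bounded_tail (a : nat -> R) (C d : R) : 0 < d ->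
  (forall s, uniq s -> \sum_(n <- s) `|a n| <= C) ->
  exists N, forall P, \sum_(N <= n < P) `|a n| <= d.
Proof.
move=> d0 aC; pose S := series (fun n => `|a n|).
have ndS : nondecreasing_seq S.
  by apply: nondecreasing_series => n _ _; exact: normr_ge0.
have cS : cvgn S.
  apply: (@series_abs_bounded_cvg _ _ C) => s us.
  by under eq_bigr do rewrite normr_id; exact: aC.
have /cvgrPdist_le/(_ _ d0)[N _ /(_ N (leqnn N))/= SN] := cS.
exists N => P; have [NP|PN] := leqP N P; last first.
  by rewrite big_geq ?ltW// ltnW.
have SP : S P <= limn S by exact: nondecreasing_cvgn_le.
have : S P = S N + \sum_(N <= n < P) `|a n|.
  by rewrite /S /series/= (big_cat_nat (leq0n N) NP).
have := ler_norm (limn S - S N); lra.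
Qed.

(** If the conclusion fails, one selects rows k_j and entries n_j with
    |a k_j n_j| > e, such that row k_j has mass at most e / 4 before the block
    [B j, B j.+1[ containing n_j and at most e / 4 after it.  With b the
    indicator of the set of the n_j, the sum of row k_j against b has absolute
    value at least e / 2 for every j, against the hypothesis for b. *)
Lemma gliding_hump (a : nat -> nat -> R) :
  (forall k, exists C : R, forall s, uniq s -> \sum_(n <- s) `|a k n| <= C) ->
  (forall b : pred nat,
    limn (series (fun n => (b n)%:R * a k n)) @[k --> \oo] --> (0 : R)) ->
  forall e : R, 0 < e -> \forall k \near \oo, forall n, `|a k n| <= e.
Proof.
move=> aC a_lim e e0.
have colP n : a k n @[k --> \oo] --> (0 : R).
  have := a_lim (pred1 n).
  rewrite (_ : (fun k => limn _) = a^~ n)//; apply/funext => k.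
  apply/cvg_lim => //; apply: cvg_near_cst; near=> N; rewrite /series/=.
  have nN : (n < N)%N by near: N; exact: nbhs_infty_gt.
  rewrite big_mkord (bigD1 (Ordinal nN))//= eqxx mul1r big1 ?addr0// => i.
  by rewrite -val_eqE/= => /negPf ->; rewrite mul0r.
have headP N : \sum_(0 <= n < N) `|a k n| @[k --> \oo] --> (0 : R).
  elim: N => [|N IH].
    by under eq_fun do rewrite big_geq//; exact: cvg_cst.
  under eq_fun do rewrite big_nat_recr//=.
  have := cvgD IH (@cvg_norm _ R^o _ _ _ _ _ (colP N)).
  by rewrite normr0 addr0 => /(_ _ _); exact.
apply: contrapT => no.
have e4 : 0 < e / 4 by rewrite divr_gt0.
(* From a starting point N: a late row k, a large entry n of it, and an end N'
   of the block, after which the row carries little mass. *)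
have /choice[w wP] : forall N, exists w : nat * nat * nat,
   let: (k, n, N') := w in
   [/\ (N <= k)%N, (N <= n < N')%N, e < `|a k n|,
     \sum_(0 <= m < N) `|a k m| <= e / 4 &
     forall P, \sum_(N' <= m < P) `|a k m| <= e / 4].
  move=> N; have [K _ KP] : \forall k \near \oo,
      (N <= k)%N /\ \sum_(0 <= m < N) `|a k m| <= e / 4.
    have /cvgrPdist_le/(_ _ e4) := headP N.
    apply: filterS2 (nbhs_infty_ge N) => k /= Nk; rewrite sub0r normrN => hk.
    by split => //; exact: le_trans (ler_norm _) hk.
  have [k [Kk [n akn]]] : exists k, (K <= k)%N /\ exists n, e < `|a k n|.
    apply: contrapT => nK; apply: no; exists K => // k /= Kk n.
    rewrite leNgt; apply/negP => akn; apply: nK; exists k; split => //.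
    by exists n.
  have [Nk hd] := KP _ Kk.
  have [C aCk] := aC k; have [T TP] := abs_bounded_tail e4 aCk.
  exists (k, n, maxn T n.+1); split => //.
    rewrite leq_max ltnSn orbT andbT leqNgt; apply/negP => nN.
    have : `|a k n| <= \sum_(0 <= m < N) `|a k m|.
      by rewrite big_mkord (bigD1 (Ordinal nN))//= lerDl sumr_ge0.
    lra.
  move=> P; apply: le_trans (TP P).
  have [PT|TPl] := leqP P (maxn T n.+1); first by rewrite big_geq// sumr_ge0.
  rewrite (@big_cat_nat _ _ _ (maxn T n.+1) T P)/= ?leq_maxl// ?(ltnW TPl)//.
  by rewrite lerDr sumr_ge0.
pose B j := iter j (fun N => (w N).2) 0%N.
pose kk j := (w (B j)).1.1; pose nn j := (w (B j)).1.2.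
have BP j : [/\ (B j <= kk j)%N, (B j <= nn j < B j.+1)%N, e < `|a (kk j) (nn j)|,
     \sum_(0 <= m < B j) `|a (kk j) m| <= e / 4 &
     forall P, \sum_(B j.+1 <= m < P) `|a (kk j) m| <= e / 4].
  have -> : B j.+1 = (w (B j)).2 by [].
  by have := wP (B j); rewrite /kk /nn; case: (w (B j)) => -[].
have Bnd : {homo B : i j / (i <= j)%N}.
  apply: homo_leq => // [i j k|i]; first exact: leq_trans.
  by have [_ /andP[h1 h2] _ _ _] := BP i; exact: ltnW (leq_ltn_trans h1 h2).
have jB j : (j <= B j)%N.
  elim: j => // j IH; apply: leq_ltn_trans IH _.
  by have [_ /andP[h1 h2] _ _ _] := BP j; exact: leq_ltn_trans h2.
pose b n := `[< exists j, n = nn j >].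
have bn j m : b m -> (B j <= m < B j.+1)%N -> m = nn j.
  move=> /asboolP[i ->] /andP[Bi iB]; congr nn; apply/eqP; rewrite eqn_leq.
  have [_ /andP[h1 h2] _ _ _] := BP i.
  apply/andP; split; rewrite leqNgt; apply/negP => /Bnd h.
    by have := leq_ltn_trans (leq_trans h h1) iB; rewrite ltnn.
  by have := leq_trans (leq_ltn_trans Bi h2) h; rewrite ltnn.
have hump j : e / 2 <= `|limn (series (fun n => (b n)%:R * a (kk j) n))|.
  have [_ /andP[Bn nB] aj hd tl] := BP j.
  have [C aCj] := aC (kk j).
  have cv : cvgn (series (fun n => (b n)%:R * a (kk j) n)).
    apply: (@series_abs_bounded_cvg _ _ (1 * C)) => s us.
    apply: abs_sum_le_mul => // n.
    by case: (b n); rewrite ?normr1 ?normr0.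
  have cv' : `|series (fun n => (b n)%:R * a (kk j) n) P| @[P --> \oo] -->
      `|limn (series (fun n => (b n)%:R * a (kk j) n))|.
    exact: (@cvg_norm _ R^o).
  apply: (cvgr_to_ge cv'); exists (B j.+1) => // P /= BPj; rewrite /series/=.
  have b1 m : `|(b m)%:R * a (kk j) m| <= `|a (kk j) m|.
    by case: (b m); rewrite ?mul1r// mul0r normr0.
  rewrite (big_cat_nat (leq0n (B j.+1)) BPj)/=.
  rewrite (big_cat_nat (leq0n (B j)) (ltnW (leq_ltn_trans Bn nB)))/=.
  have -> : \sum_(B j <= m < B j.+1) (b m)%:R * a (kk j) m = a (kk j) (nn j).
    rewrite (@big_cat_nat _ _ _ (nn j))//= 1?ltnW// (big_ltn nB).
    have bnn : b (nn j) by apply/asboolP; exists j.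
    rewrite bnn mul1r big_nat big1 ?add0r => [|m /andP[h1 h2]].
      rewrite big_nat big1 ?addr0// => m /andP[h1 h2].
      case: (boolP (b m)) => [/(bn j)|]; rewrite ?mul0r//.
      rewrite h2 (leq_trans Bn (ltnW h1)) => /(_ isT) mE.
      by rewrite mE ltnn in h1.
    case: (boolP (b m)) => [/(bn j)|]; rewrite ?mul0r//.
    rewrite h1 (ltn_trans h2 nB) => /(_ isT) mE.
    by rewrite mE ltnn in h2.
  set h := \sum_(_ <= _ < _) _; set t := \sum_(_ <= _ < _) _.
  have hle : `|h| <= e / 4.
    apply: le_trans (ler_norm_sum _ _ _) _; apply: le_trans hd.
    by apply: ler_sum => m _; exact: b1.
  have tle : `|t| <= e / 4.
    apply: le_trans (ler_norm_sum _ _ _) _; apply: le_trans (tl P).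
    by apply: ler_sum => m _; exact: b1.
  have : `|a (kk j) (nn j)| <= `|h + a (kk j) (nn j) + t| + `|h| + `|t|.
    have {1}-> : a (kk j) (nn j) = h + a (kk j) (nn j) + t - h - t by lra.
    by rewrite (le_trans (ler_normB _ _))// lerD2r ler_normB.
  lra.
have /cvgrPdist_le/(_ _ e4)[K _ KP] := a_lim b.
have := KP (kk K); rewrite /= sub0r normrN.
have [Bk _ _ _ _] := BP K.
move=> /(_ (leq_trans (jB K) Bk)).
have := hump K; lra.
Unshelve. all: by end_near. Qed.

End gliding_hump.

(** * Right null sequences and Right* sets *)

Section right_sequences.
Context {R : realType}.

Lemma bounded_set_le (V : normedModType R) (K : set V) (M : R) :
  (forall x, K x -> `|x| <= M) -> bounded_set K.
Proof.
move=> KM; exists M; split => [|r /ltW Mr x /= Kx]; first exact: num_real.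
exact: le_trans (KM x Kx) Mr.
Qed.

Lemma sup_dual_cvg0 (V : normedModType R) (K : set V) (f : nat -> dual V) :
  bounded_set K -> f @ \oo --> (0 : dual V) ->
  sup [set `|f n x| | x in K] @[n --> \oo] --> (0 : R^o).
Proof.
move=> /pinfty_ex_gt0[M M0 KM] f0.
apply/cvgrPdist_le => e e0; have eM : 0 < e / M by exact: divr_gt0.
have /cvgrPdist_le/(_ _ eM) := f0; apply: filterS => n; rewrite !sub0r !normrN.
rewrite ler_pdivlMr// => fM.
have [->|/set0P[x Kx]] := eqVneq K set0; first by rewrite image_set0 sup0 normr0 ltW.
have fK y : K y -> `|f n y| <= e.
  move=> Ky; apply: le_trans (le_dual_norm _ _) _; apply: le_trans fM.
  by rewrite ler_wpM2l ?dual_norm_ge0//; exact: KM.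
rewrite ger0_norm.
  by apply: ge_sup => [|_ [y Ky <-]]; [exists `|f n x|, x|exact: fK].
apply: le_trans (normr_ge0 (f n x)) _; apply: ub_le_sup; last by exists x.
by exists e => _ [y Ky <-]; exact: fK.
Qed.

(** For finite p, |t|^p <= C^(p-1) |t| when |t| <= C. *)
Lemma weakly_summable_of_abs_bounded (Z : completeNormedModType R) (p : \bar R)
    (z : nat -> Z) :
  (1 <= p)%E ->
  (forall f : dual Z, exists C : R,
    forall s, uniq s -> \sum_(n <- s) `|f (z n)| <= C) ->
  weakly_summable p z.
Proof.
case: p => [q||] //=; last first.
  move=> _ zC f; have [C fC] := zC f.
  exact: (@cvg_series_cvg_0 _ R^o _ (series_abs_bounded_cvg fC)).
rewrite lee_fin => q1 zC f; have [C fC] := zC f.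
have C0 : 0 <= C by have := fC [::]; rewrite big_nil; exact.
have fzC n : `|f (z n)| <= C by have := fC [:: n]; rewrite big_seq1; exact.
have -> : (fun n => `|f (z n)| `^ q) = (fun n => `|f (z n)| `^ (q - 1) * `|f (z n)|).
  apply/funext => n; rewrite -[X in _ = _ * X]powRr1// -powRD ?subrK//.
  by apply/implyP => /eqP h; move: q1; rewrite h ler10.
apply: (@series_abs_bounded_cvg _ _ (C `^ (q - 1) * C)) => s us.
apply: abs_sum_le_mul => // [n|t ut]; last first.
  by under eq_bigr do rewrite normr_id; exact: fC.
by rewrite ger0_norm ?powR_ge0// ge0_ler_powR// ?subr_ge0// nnegrE.
Qed.

Lemma dual_evaluation (Z : normedModType R) :
  exists J : Z -> dual (dual Z), forall z f, J z f = f z.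
Proof.
have /choice[J JP] : forall z : Z, exists g : dual (dual Z), forall f : dual Z, g f = f z.
  move=> z; apply: (@bounded_linear_dual R (dual Z) (fun f => f z) `|z|).
    by [].
  by move=> f; rewrite mulrC; exact: le_dual_norm.
by exists J.
Qed.

(** Weak nullity of (f k) is tested against the functionals on Z* that sum the
    values f (z n) over a set of indices, as the gliding hump requires. *)
Lemma dunford_pettis_of_wuC (Z : completeNormedModType R) (z : nat -> Z) (C : R) :
  0 <= C ->
  (forall (f : dual Z) s, uniq s -> \sum_(n <- s) `|f (z n)| <= C * `|f|) ->
  (exists M, forall n, `|z n| <= M) ->
  dunford_pettis_set (range z).
Proof.
move=> C0 zC [M zM]; split.
  by apply: (@bounded_set_le _ _ M) => _ [n _ <-].
move=> f f0; have [J JE] := dual_evaluation Z.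
have JC : wuC_bound (J \o z) C.
  by move=> g s us; under eq_bigr do rewrite /= JE; exact: zC.
have fz e : 0 < e -> \forall k \near \oo, forall n, `|f k (z n)| <= e.
  apply: (@gliding_hump R (fun k n => f k (z n))) => [k|b].
    by exists (C * `|f k|); exact: zC.
  have [|g [_ gP]] := wuC_functional (b := fun n => (b n)%:R) (M := 1) C0 JC.
    by move=> n; rewrite normr_nat lern1 leq_b1.
  have := f0 g; rewrite (_ : (fun k => g (f k)) =
    (fun k => limn (series (fun n => (b n)%:R * f k (z n)))))//.
  apply/funext => k; apply/esym/cvg_lim => //.
  have := gP (f k); rewrite (_ : (fun n => _) = (fun n => (b n)%:R * f k (z n)))//.
  by apply/funext => n /=; rewrite JE.
move=> P /uniform_nbhs[E [+ EP]]; rewrite -entourage_ballE => -[e /= e0 eE].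
have e2 : 0 < e / 2 by rewrite divr_gt0.
apply: filterS (fz _ e2) => k fk; apply: EP => _ [n _ <-]; apply: eE.
rewrite /= -ball_normE/= sub0r normrN (le_lt_trans (fk n))//; lra.
Qed.

Lemma c0_unit_vectors :
  exists d : nat -> c0 R, forall n m, d n m = (m == n)%:R.
Proof.
suff /choice[d dE] : forall n, exists d : c0 R, forall m, d m = (m == n)%:R.
  by exists d.
move=> n; suff dP : (fun m => (m == n)%:R : R^o) \in @c0_pred R by exists (C0 dP).
rewrite inE /=; apply: cvg_near_cst; near=> m; rewrite gtn_eqF//.
by near: m; exact: nbhs_infty_gt.
Unshelve. all: by end_near. Qed.

(** Choosing signs c n, the sum is the value of f at the image of the vector
    with coordinates c n, which lies in the unit ball of c0. *)
Lemma c0_image_wuC (Z : normedModType R) (T : {linear c0 R -> Z}) (B : R)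
    (d : nat -> c0 R) (f : dual Z) (s : seq nat) :
  0 <= B -> (forall y, `|T y| <= B * `|y|) ->
  (forall n m, d n m = (m == n)%:R) -> uniq s ->
  \sum_(n <- s) `|f (T (d n))| <= B * `|f|.
Proof.
move=> B0 TB dE us; pose c n := Num.sg (f (T (d n))).
pose y : c0 R := \sum_(n <- s) c n *: d n.
have yE m : y m = \sum_(n <- s) c n * (m == n)%:R.
  under eq_bigr do rewrite -dE.
  by rewrite /y; elim/big_rec2: _ => // n u v _ <-.
have y1 : `|y| <= 1.
  apply: c0_norm_le => m; rewrite yE.
  have [ms|ms] := boolP (m \in s).
    rewrite (bigD1_seq m)//= eqxx mulr1 big1 => [|n /negPf nm]; last first.
      by rewrite eq_sym nm mulr0.
    by rewrite addr0 /c normr_sg lern1 leq_b1.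
  rewrite big_seq big1 ?normr0// => n ns.
  by rewrite (_ : m == n = false) ?mulr0//; apply/eqP => mn; rewrite mn ns in ms.
have <- : f (T y) = \sum_(n <- s) `|f (T (d n))|.
  rewrite /y !linear_sum; apply: eq_bigr => n _.
  by rewrite !linearZ /= [RHS]normrEsg.
apply: le_trans (ler_norm _) _; apply: le_trans (le_dual_norm _ _) _.
rewrite mulrC ler_wpM2r ?dual_norm_ge0// (le_trans (TB _))// ler_piMr//.
Qed.

(** The images of the unit vectors form a p-Right null sequence bounded away
    from 0. *)
Lemma not_DPrcP_of_c0_copy (p : \bar R) (Z : completeNormedModType R) :
  (1 <= p)%E -> contains_copy (c0 R) Z -> ~ DPrcP p Z.
Proof.
move=> p1 [T [A [B [A0 B0 TAB]]]] DP; have [d dE] := c0_unit_vectors.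
have TB y : `|T y| <= B * `|y| by have /andP[] := TAB y.
have d1 n : `|d n| <= 1.
  by apply: c0_norm_le => m; rewrite dE normr_nat lern1 leq_b1.
have TC (f : dual Z) s : uniq s -> \sum_(n <- s) `|f (T (d n))| <= B * `|f|.
  by move=> us; apply: c0_image_wuC => //; exact: ltW.
have /DP/cvgrPdist_lt/(_ _ A0)[N _ /(_ N (leqnn N))] : Right_null p (T \o d).
  split.
    apply: weakly_summable_of_abs_bounded => // f.
    by exists (B * `|f|) => s; exact: TC.
  apply: (dunford_pettis_of_wuC (ltW B0)) => //.
  by exists B => n; rewrite (le_trans (TB _))// ler_piMr// ltW.
rewrite /= sub0r normrN ltNge => /negP[].
have /andP[AT _] := TAB (d N); apply: le_trans AT; rewrite ler_peMr ?(ltW A0)//.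
by have := le_c0_norm (d N) N; rewrite dE eqxx normr1.
Qed.

(** Evaluations at points of X are among the functionals on X* that weak
    summability tests, and they suffice. *)
Lemma weakly_1summable_cvg0 (X : completeNormedModType R) (x : nat -> dual X) :
  ~ contains_copy (c0 R) (dual X) -> weakly_summable 1%:E x ->
  x @ \oo --> (0 : dual X).
Proof.
move=> nc0 x1; apply: contrapT => nx; apply: nc0.
have [J JE] := dual_evaluation X.
have [|C C0 xC] := @wuC_bound_of_pointwise R X x; last exact: contains_c0_of_wuC xC nx.
move=> u; have := x1 (J u); rewrite (_ : (fun n => _) = (fun n => `|x n u|))//.
by apply/funext => n; rewrite JE powRr1.
Qed.

End right_sequences.

Theorem theorem4p10 (R : realType) (p : \bar R) (X : completeNormedModType R)
    (hp : (1%:E < p)%E) :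
  DPrcP p (dual X) <-> (SRstar 1%:E p X /\ ~ contains_copy (c0 R) (dual X)).
Proof.
split=> [DP|[SR nc0] z zR].
  split=> [K [bK _]|c0X]; last exact: not_DPrcP_of_c0_copy (ltW hp) c0X DP.
  by split => // f fR; exact: sup_dual_cvg0 (DP f fR).
pose B := [set x : X | `|x| <= 1].
have bB : bounded_set B by apply: (@bounded_set_le _ _ _ 1).
have /SR[_ /(_ z zR) Bz] : Right_star_set 1%:E B.
  split => // f [f1 _]; apply: sup_dual_cvg0 => //.
  exact: weakly_1summable_cvg0.
exact/norm_cvg0P.
Qed.
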